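(* Let $\Gamma$ be a polycyclic-by-finite group and let $\tau_\Gamma$ denote its maximal finite normal subgroup. Then the natural homomorphism $\mathrm{Out}(\Gamma)\to\mathrm{Out}(\Gamma/\tau_\Gamma)$ has finite kernel and maps $\mathrm{Out}(\Gamma)$ onto a finite index subgroup of $\mathrm{Out}(\Gamma/\tau_\Gamma)$.
   Context: A group is polycyclic-by-finite if it has a polycyclic subgroup of finite index; such a group has a maximal finite normal subgroup $\tau_\Gamma$, which is characteristic, so automorphisms of $\Gamma$ induce automorphisms of $\Gamma/\tau_\Gamma$. $\mathrm{Out}(\Gamma)=\mathrm{Aut}(\Gamma)/\mathrm{Inn}_\Gamma$ denotes the outer automorphism group. *)

(* Defs.v *)
From HB Require Import structures.
From mathcomp Require Import all_boot.
From mathcomp Require Import boolp classical_sets functions cardinality.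

Set Implicit Arguments.
Unset Strict Implicit.
Unset Printing Implicit Defensive.

Local Open Scope classical_set_scope.
Local Open Scope quotient_scope.
Local Open Scope group_scope.

Section Subgroups.
Variable G : groupType.
Implicit Types H K : set G.

Definition is_subgroup H : Prop :=
  [/\ H 1, forall x y, H x -> H y -> H (x * y) & forall x, H x -> H x^-1].

Definition is_normal H : Prop :=
  is_subgroup H /\ forall x g, H x -> H (x ^ g).

Definition lcoset H (x : G) : set G := [set x * h | h in H].

Definition finite_index H : Prop := finite_set (range (lcoset H)).

Definition normal_in K H : Prop :=
  [/\ is_subgroup K, K `<=` H & forall x g, K x -> H g -> K (x ^ g)].

(* [H / K] is cyclic: every coset [x K] with [x] in [H] is a power of one
   coset [g K]. *)
Definition cyclic_factor H K : Prop :=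
  exists2 g, H g & forall x, H x ->
    exists k : nat, lcoset K (g ^+ k) x \/ lcoset K (g ^- k) x.

(* [H] is a polycyclic subgroup of [G], by a series
   [H = S 0, S 1, ..., S n = 1]. *)
Definition polycyclic H : Prop :=
  is_subgroup H /\
  exists (n : nat) (S : nat -> set G),
    [/\ S 0 = H, S n = [set 1] &
        forall i, (i < n)%N ->
          normal_in (S i.+1) (S i) /\ cyclic_factor (S i) (S i.+1)].

End Subgroups.

Definition polycyclic_by_finite (G : groupType) : Prop :=
  exists2 P : set G, polycyclic P & finite_index P.

Record normalSubgroup (G : groupType) := NormalSubgroup {
  carrier :> set G;
  normalSubgroupP : is_normal carrier }.

Section NormalSubgroupTheory.
Variables (G : groupType) (N : normalSubgroup G).

Lemma ns1 : carrier N 1. Proof. by case: (normalSubgroupP N) => -[]. Qed.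
Lemma nsM x y : carrier N x -> carrier N y -> carrier N (x * y).
Proof. by case: (normalSubgroupP N) => -[_ NM _] _; exact: NM. Qed.
Lemma nsV x : carrier N x -> carrier N x^-1.
Proof. by case: (normalSubgroupP N) => -[_ _ NV] _; exact: NV. Qed.
Lemma nsJ x g : carrier N x -> carrier N (x ^ g).
Proof. by case: (normalSubgroupP N) => _ NJ; exact: NJ. Qed.

End NormalSubgroupTheory.

Section Quotient.
Variables (G : groupType) (N : normalSubgroup G).

Definition coset_eq : rel G := fun x y => `[< carrier N (x^-1 * y) >].

Lemma coset_eqP : equiv_class_of coset_eq.
Proof.
split=> [x|x y|y x z]; first by apply/asboolP; rewrite mulVg; exact: ns1.
  by apply: asbool_equiv_eq; split=> /nsV; rewrite invgM invgK.
move=> /asboolP xy /asboolP yz; apply/asboolP.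
by have := nsM xy yz; rewrite mulgA mulgK.
Qed.

Canonical coset_equiv := EquivRelPack coset_eqP.

(* The quotient group [G / N]. *)
Definition quot : Type := {eq_quot coset_equiv}.

HB.instance Definition _ := Choice.on quot.
HB.instance Definition _ := Quotient.on quot.

Definition coset (x : G) : quot := \pi_quot x.

Lemma coset_repr (a : quot) : coset (repr a) = a.
Proof. exact: reprK. Qed.

Lemma eq_coset x y : coset x = coset y <-> carrier N (x^-1 * y).
Proof.
rewrite /coset; split.
  by move=> /eqquotP /asboolP.
by move=> Nxy; apply/eqquotP/asboolP.
Qed.

Definition quot_mul (a b : quot) : quot := coset (repr a * repr b).
Definition quot_one : quot := coset 1.
Definition quot_inv (a : quot) : quot := coset (repr a)^-1.

Lemma quot_mulE x y : quot_mul (coset x) (coset y) = coset (x * y).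
Proof.
apply/eq_coset; rewrite invgM.
have /eq_coset Nx := coset_repr (coset x).
have /eq_coset Ny := coset_repr (coset y).
have := nsM (nsJ (repr (coset y)) Nx) Ny.
by rewrite /conjg !mulgA mulgK.
Qed.

Lemma quot_invE x : quot_inv (coset x) = coset x^-1.
Proof.
apply/eq_coset; rewrite invgK.
have /eq_coset Nx := coset_repr (coset x).
have := nsJ (repr (coset x))^-1 (nsV Nx).
by rewrite /conjg !invgM !invgK !mulgA mulgK.
Qed.

Lemma quot_mulA : associative quot_mul.
Proof.
move=> a b c; rewrite -(coset_repr a) -(coset_repr b) -(coset_repr c).
by rewrite !quot_mulE mulgA.
Qed.

Lemma quot_mul1 : left_id quot_one quot_mul.
Proof. by move=> a; rewrite -(coset_repr a) quot_mulE mul1g. Qed.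

Lemma quot_1mul : right_id quot_one quot_mul.
Proof. by move=> a; rewrite -(coset_repr a) quot_mulE mulg1. Qed.

Lemma quot_mulV : left_inverse quot_one quot_inv quot_mul.
Proof.
by move=> a; rewrite -(coset_repr a) quot_invE quot_mulE mulVg.
Qed.

Lemma quot_Vmul : right_inverse quot_one quot_inv quot_mul.
Proof.
by move=> a; rewrite -(coset_repr a) quot_invE quot_mulE mulgV.
Qed.

HB.instance Definition _ :=
  isGroup.Build quot quot_mulA quot_mul1 quot_1mul quot_mulV quot_Vmul.

Lemma cosetM : {morph coset : x y / x * y}.
Proof. by move=> x y; rewrite -quot_mulE. Qed.

HB.instance Definition _ :=
  isUMagmaMorphism.Build G quot coset (erefl, cosetM).

Lemma coset_eq1 x : coset x = 1 <-> carrier N x.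
Proof.
by rewrite -[1]/(coset 1) (rwP eqP) eq_sym -(rwP eqP) eq_coset invg1 mul1g.
Qed.

End Quotient.

Section Automorphisms.
Variable G : groupType.

Definition is_aut (f : G -> G) : bool :=
  `[< {morph f : x y / x * y} /\ bijective f >].

Record Aut := MkAut { aut_fun :> G -> G; aut_funP : is_aut aut_fun }.

HB.instance Definition _ := [isSub for aut_fun].
HB.instance Definition _ := [Choice of Aut by <:].

Lemma autP (f g : Aut) : f =1 g -> f = g.
Proof. by move=> fg; apply: val_inj; exact: funext. Qed.

Lemma autM (f : Aut) : {morph f : x y / x * y}.
Proof. by have /asboolP[] := aut_funP f. Qed.

Lemma aut_bij (f : Aut) : bijective f.
Proof. by have /asboolP[] := aut_funP f. Qed.

Lemma aut1 (f : Aut) : f 1 = 1.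
Proof. by apply: (mulgI (f 1)); rewrite -autM !mulg1. Qed.

Lemma autV (f : Aut) x : f x^-1 = (f x)^-1.
Proof. by apply: (mulgI (f x)); rewrite -autM !mulgV aut1. Qed.

HB.instance Definition _ (f : Aut) :=
  isUMagmaMorphism.Build G G (aut_fun f) (aut1 f, autM f).

Lemma autJ (f : Aut) x g : f (x ^ g) = f x ^ f g.
Proof. by rewrite /conjg !autM autV. Qed.

Lemma is_aut_id : is_aut idfun.
Proof. by apply/asboolP; split=> //; exists idfun. Qed.

Lemma is_aut_comp (f g : Aut) : is_aut (f \o g).
Proof.
apply/asboolP; split=> [x y /=|]; first by rewrite !autM.
exact: bij_comp (aut_bij f) (aut_bij g).
Qed.

Lemma aut_inv_ex (f : Aut) : exists h : G -> G, cancel f h /\ cancel h f.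
Proof. by case: (aut_bij f) => h fK hK; exists h. Qed.

Definition aut_invfun (f : Aut) : G -> G := sval (cid (aut_inv_ex f)).

Lemma aut_invK (f : Aut) : cancel f (aut_invfun f).
Proof. by rewrite /aut_invfun; case: cid => h []. Qed.

Lemma aut_Kinv (f : Aut) : cancel (aut_invfun f) f.
Proof. by rewrite /aut_invfun; case: cid => h []. Qed.

Lemma is_aut_inv (f : Aut) : is_aut (aut_invfun f).
Proof.
apply/asboolP; split; last by exists f; [exact: aut_Kinv | exact: aut_invK].
by move=> x y; apply: (can_inj (aut_invK f)); rewrite autM !aut_Kinv.
Qed.

Definition aut_one : Aut := MkAut is_aut_id.
Definition aut_mul (f g : Aut) : Aut := MkAut (is_aut_comp f g).
Definition aut_inv (f : Aut) : Aut := MkAut (is_aut_inv f).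

Lemma aut_mulA : associative aut_mul. Proof. by move=> f g h; exact: autP. Qed.
Lemma aut_mul1 : left_id aut_one aut_mul.
Proof. by move=> f; exact: autP. Qed.
Lemma aut_1mul : right_id aut_one aut_mul.
Proof. by move=> f; exact: autP. Qed.
Lemma aut_mulV : left_inverse aut_one aut_inv aut_mul.
Proof. by move=> f; apply: autP => x /=; rewrite aut_invK. Qed.
Lemma aut_Vmul : right_inverse aut_one aut_inv aut_mul.
Proof. by move=> f; apply: autP => x /=; rewrite aut_Kinv. Qed.

HB.instance Definition _ :=
  isGroup.Build Aut aut_mulA aut_mul1 aut_1mul aut_mulV aut_Vmul.

Lemma aut_mulE (f g : Aut) x : (f * g) x = f (g x). Proof. by []. Qed.

Lemma aut_KV (f : Aut) x : f^-1 (f x) = x. Proof. exact: aut_invK. Qed.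
Lemma aut_VK (f : Aut) x : f (f^-1 x) = x. Proof. exact: aut_Kinv. Qed.

Definition inner : set Aut := [set f | exists g, forall x, f x = x ^ g].

Lemma inner_normal : is_normal inner.
Proof.
split.
  split.
  - by exists 1 => x; rewrite conjg1.
  - move=> f g [a fa] [b gb]; exists (b * a) => x.
    by rewrite aut_mulE fa gb conjgM.
  - move=> f [a fa]; exists a^-1 => x; apply: (can_inj (aut_invK f)).
    by rewrite aut_VK fa conjgKV.
move=> f g [a fa]; exists (g^-1 a) => x.
apply: (can_inj (aut_invK g)).
by rewrite [f ^ g]conjgE autJ !aut_mulE !aut_VK fa.
Qed.

Definition Inn : normalSubgroup Aut := NormalSubgroup inner_normal.

End Automorphisms.

Definition Out (G : groupType) : groupType := quot (Inn G).

Definition characteristic (G : groupType) (N : set G) : Prop :=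
  forall f : Aut G, f @` N = N.

Section NaturalMap.
Variables (G : groupType) (N : normalSubgroup G).
Hypothesis charN : characteristic N.

Lemma char_mem (f : Aut G) x : carrier N (f x) <-> carrier N x.
Proof.
split; last by move=> Nx; rewrite -(charN f); exists x.
by rewrite -{1}(charN f) => -[y Ny /(can_inj (aut_invK f)) <-].
Qed.

Definition quot_fun (f : Aut G) (a : quot N) : quot N := coset N (f (repr a)).

Lemma quot_funE f x : quot_fun f (coset N x) = coset N (f x).
Proof.
apply/eq_coset; rewrite -autV -autM; apply/char_mem.
by apply/eq_coset; rewrite coset_repr.
Qed.

Lemma quot_fun_aut f : is_aut (quot_fun f).
Proof.
apply/asboolP; split.
  move=> a b; rewrite -(coset_repr a) -(coset_repr b) -cosetM !quot_funE.
  by rewrite autM cosetM.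
exists (quot_fun f^-1) => a; rewrite -(coset_repr a) !quot_funE.
  by rewrite aut_KV.
by rewrite aut_VK.
Qed.

(* The automorphism [x N |-> f x N] of [G / N]. *)
Definition aut_quot (f : Aut G) : Aut (quot N) := MkAut (quot_fun_aut f).

Lemma aut_quotE f x : aut_quot f (coset N x) = coset N (f x).
Proof. exact: quot_funE. Qed.

Lemma aut_quotM : {morph aut_quot : f g / f * g}.
Proof.
move=> f g; apply: autP => a; rewrite -(coset_repr a) aut_mulE.
by rewrite !aut_quotE.
Qed.

Lemma aut_quot1 : aut_quot 1 = 1.
Proof. by apply: (mulgI (aut_quot 1)); rewrite -aut_quotM !mulg1. Qed.

HB.instance Definition _ :=
  isUMagmaMorphism.Build (Aut G) (Aut (quot N)) aut_quot (aut_quot1, aut_quotM).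

Lemma aut_quot_inner f : inner f -> inner (aut_quot f).
Proof.
move=> [g fg]; exists (coset N g) => a; rewrite -(coset_repr a) aut_quotE fg.
by rewrite gmulfJ.
Qed.

Definition out_quot (u : Out G) : Out (quot N) :=
  coset (Inn (quot N)) (aut_quot (repr u)).

Lemma out_quotE f :
  out_quot (coset (Inn G) f) = coset (Inn (quot N)) (aut_quot f).
Proof.
apply/eq_coset; rewrite -gmulfV -gmulfM; apply: aut_quot_inner.
by apply/(@eq_coset _ (Inn G)); rewrite coset_repr.
Qed.

Lemma out_quotM : {morph out_quot : u v / u * v}.
Proof.
move=> u v; rewrite -(coset_repr u) -(coset_repr v) -cosetM !out_quotE.
by rewrite aut_quotM cosetM.
Qed.

Lemma out_quot1 : out_quot 1 = 1.
Proof. by apply: (mulgI (out_quot 1)); rewrite -out_quotM !mulg1. Qed.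

HB.instance Definition _ :=
  isUMagmaMorphism.Build (Out G) (Out (quot N)) out_quot (out_quot1, out_quotM).

End NaturalMap.

Definition kernel (G H : groupType) (phi : {multiplicative G -> H}) : set G :=
  [set x | phi x = 1].

Definition maximal_finite_normal (G : groupType) (T : normalSubgroup G) : Prop :=
  finite_set T /\
  forall N : normalSubgroup G, finite_set N -> T `<=` N -> T = N :> set G.

Section MaximalFiniteNormal.
Variables (G : groupType) (T : normalSubgroup G).
Hypothesis maxT : maximal_finite_normal T.

(* Products of finite normal subgroups are finite normal subgroups, so a
   maximal one is the largest one. *)
Lemma maximal_finite_normal_largest (N : normalSubgroup G) :
  finite_set N -> N `<=` T.
Proof.
case: maxT => finT maxT' finN.
pose M : set G := [set x * y | x in T & y in N].
have nM : is_normal M.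
  split; first split.
  - by exists 1; [exact: ns1 | exists 1; [exact: ns1 | rewrite mulg1]].
  - move=> _ _ [a Ta [b Nb <-]] [c Tc [d Nd <-]].
    exists (a * c); first exact: nsM.
    exists (b ^ c * d); first by apply: nsM => //; exact: nsJ.
    by rewrite /conjg !mulgA mulgK.
  - move=> _ [a Ta [b Nb <-]]; exists a^-1; first exact: nsV.
    exists (b^-1 ^ a^-1); first by apply/nsJ/nsV.
    by rewrite /conjg invgK !mulgA mulVg mul1g invgM.
  - move=> _ g [a Ta [b Nb <-]]; exists (a ^ g); first exact: nsJ.
    by exists (b ^ g); [exact: nsJ | rewrite conjMg].
have finM : finite_set M by exact: finite_image2.
have TM : T `<=` M.
  by move=> x Tx; exists x => //; exists 1; [exact: ns1 | rewrite mulg1].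
rewrite (maxT' (NormalSubgroup nM) finM TM) => x Nx.
by exists 1; [exact: ns1 | exists x => //; rewrite mul1g].
Qed.

Lemma maximal_finite_normal_char : characteristic T.
Proof.
have stab (f : Aut G) : f @` T `<=` T.
  have nfT : is_normal (f @` T).
    split; first split.
    - by exists 1; [exact: ns1 | rewrite aut1].
    - move=> _ _ [x Tx <-] [y Ty <-].
      by exists (x * y); [exact: nsM | rewrite autM].
    - by move=> _ [x Tx <-]; exists x^-1; [exact: nsV | rewrite autV].
    - move=> _ g [x Tx <-]; exists (x ^ f^-1 g); first exact: nsJ.
      by rewrite autJ aut_VK.
  apply: (@maximal_finite_normal_largest (NormalSubgroup nfT)).
  by apply: finite_image; case: maxT.
move=> f; apply/seteqP; split=> // x Tx; exists (f^-1 x).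
  by apply: (stab f^-1); exists x.
by rewrite aut_VK.
Qed.

Definition natural_out : {multiplicative Out G -> Out (quot T)} :=
  out_quot maximal_finite_normal_char.

End MaximalFiniteNormal.

(* Main.v *)
Require Import Defs.
From mathcomp Require Import all_boot.
From mathcomp Require Import boolp classical_sets functions cardinality.

Local Open Scope classical_set_scope.
Local Open Scope group_scope.

Set Implicit Arguments.
Unset Strict Implicit.
Unset Printing Implicit Defensive.

(** Write [G] for the polycyclic-by-finite group, [N] for its maximal finite
normal subgroup and [Q] for [G / N]. Two properties of [G] are enough: it is
finitely generated, and it has a normal subgroup [D] of finite index that is
torsion-free and therefore meets the finite group [N] trivially.

Finite kernel. A class in the kernel of [Out G -> Out Q] is represented, after
correction by an inner automorphism, by some [f] inducing the identity on [Q]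
([kernel_out_quot_rep]). Such an [f] moves each of the finitely many
generators of [G] by one of the finitely many elements of [N], so there are
only finitely many such [f].

Finite cokernel. Since [D] meets [N] trivially, [G] is the fibre product of
[Q] and [G / D] over [G / DN]. An automorphism of [Q] that is trivial modulo
the image of [D] can be paired with the identity of [G / D], and so lifts to
[G] ([trivial_mod_lift]). These automorphisms are the stabiliser of the
projection of [Q] onto the finite group [G / DN] under precomposition, and a
finitely generated group has only finitely many homomorphisms to a finite
group; so they form a subgroup of finite index in [Aut Q]
([finite_index_out_quot]).

The subgroup [D] is generated by the [m]-th powers in [G], for a suitable
[m > 0]. It is normal for every [m], and of finite index because a polycyclic
group of finite exponent is finite ([finitely_covered_exponent]). That some
[m] makes it torsion-free is proved by induction along the polycyclic series
([polycyclic_torsion_free]). *)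

(** * Subgroups, normalisation and power subgroups *)

Section SubgroupTools.
Variable G : groupType.
Implicit Types (H K T : set G) (g x y : G).

Lemma subgroup_exp H x n : is_subgroup H -> H x -> H (x ^+ n).
Proof.
by case=> H1 HM _ Hx; elim: n => [|n IH]; rewrite ?expg0 ?expgS //; exact: HM.
Qed.

Definition normalised K H := forall x h, K x -> H h -> K (x ^ h).

Definition torsion_free H := forall x n, H x -> x ^+ n.+1 = 1 -> x = 1.

Definition generated (A : set G) : set G :=
  [set x | forall H, is_subgroup H -> A `<=` H -> H x].

Lemma generated_subgroup A : is_subgroup (generated A).
Proof.
split=> [H [H1 _ _] _ //|x y Ax Ay H sH AH|x Ax H sH AH].
  by case: (sH) => _ HM _; apply: HM; [exact: Ax | exact: Ay].
by case: (sH) => _ _ HV; apply: HV; exact: Ax.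
Qed.

Lemma sub_generated A : A `<=` generated A.
Proof. by move=> x Ax H _; apply. Qed.

Lemma generated_sub A H : is_subgroup H -> A `<=` H -> generated A `<=` H.
Proof. by move=> sH AH x; apply. Qed.

Definition power_subgroup H m := generated [set h ^+ m | h in H].

Lemma power_subgroup_normalised H N m :
  normalised H N -> normalised (power_subgroup H m) N.
Proof.
move=> nHN x h Hx Nh; move: x Hx.
case: (generated_subgroup [set h ^+ m | h in H]) => P1 PM PV.
apply: (@generated_sub _ [set x | power_subgroup H m (x ^ h)]).
  split=> [|x y Px Py|x Px] /=; first by rewrite conj1g.
    by rewrite conjMg; exact: PM.
  by rewrite conjVg; exact: PV.
move=> _ [x Hx <-] /=; rewrite conjXg; apply: sub_generated.
by exists (x ^ h) => //; exact: nHN.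
Qed.

Definition powers g : set G := [set x | exists k, x = g ^+ k \/ x = g ^- k].

Lemma powers_subgroup g : is_subgroup (powers g).
Proof.
have mixed j k : powers g (g ^+ j / g ^+ k).
  have [le_kj | /ltnW le_jk] := leqP k j.
    by exists (j - k)%N; left; rewrite expgnFr.
  by exists (k - j)%N; right; rewrite expgnFr // invgF.
split; first by exists 0; left.
- move=> _ _ [j [->|->]] [k [->|->]] //.
  + by exists (j + k)%N; left; rewrite expgnDr.
  + suff -> : g ^- j * g ^+ k = g ^+ k / g ^+ j by [].
    by symmetry; apply: commuteV; exact: commuteX2.
  + by exists (k + j)%N; right; rewrite expgnDr invgM.
- by move=> _ [k [->|->]]; exists k; [right | left; rewrite invgK].
Qed.

Lemma sub_powers g H : is_subgroup H -> H g -> powers g `<=` H.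
Proof.
move=> sH Hg _ [k [->|->]]; first exact: subgroup_exp.
by case: (sH) => _ _ HV; apply: HV; exact: subgroup_exp.
Qed.

(** This is [(z y)^n = z^n] in the quotient by [K], stated without forming the
quotient. *)
Lemma expg_mulr_mod H K z y n : is_subgroup H -> is_subgroup K ->
  normalised K H -> H z -> K y -> exists2 y', K y' & (z * y) ^+ n = z ^+ n * y'.
Proof.
move=> sH sK nKH Hz Ky; case: (sK) => K1 KM _.
elim: n => [|n [y' Ky' IH]]; first by exists 1; rewrite ?mulg1.
exists (y ^ (z ^+ n) * y').
  by apply: KM => //; apply: nKH => //; exact: subgroup_exp.
by rewrite !expgS IH conjgE !mulgA mulgK.
Qed.

Lemma mulg_subgroup K Z : is_subgroup K -> is_subgroup Z -> normalised K Z ->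
  is_subgroup [set x * z | x in K & z in Z].
Proof.
move=> [K1 KM KV] [Z1 ZM ZV] nKZ; split.
- by exists 1 => //; exists 1 => //; rewrite mulg1.
- move=> _ _ [a Ka [b Zb <-]] [c Kc [d Zd <-]].
  exists (a * c ^ b^-1); first by apply: KM => //; apply: nKZ => //; exact: ZV.
  by exists (b * d); [exact: ZM | rewrite conjgE invgK !mulgA mulgVK].
- move=> _ [a Ka [b Zb <-]]; exists (a^-1 ^ b).
    by apply: nKZ => //; exact: KV.
  by exists b^-1; [exact: ZV | rewrite conjgE invgM !mulgA mulgK].
Qed.

(** * Induction along a polycyclic series *)

Lemma cyclic_factor_gen H K : cyclic_factor H K ->
  exists2 g, H g & forall x, H x ->
    exists z y, [/\ powers g z, K y & x = z * y].
Proof.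
move=> [g Hg gen]; exists g => // x /gen[k [] [y Ky <-]].
  by exists (g ^+ k), y; split=> //; exists k; left.
by exists (g ^- k), y; split=> //; exists k; right.
Qed.

Lemma polycyclic_ind (Q : set G -> Prop) :
  Q [set 1] ->
  (forall H K, is_subgroup H -> polycyclic K -> normal_in K H ->
     cyclic_factor H K -> Q K -> Q H) ->
  forall H, polycyclic H -> Q H.
Proof.
move=> Q1 Qstep H [sH [n [S [S0 Sn ser]]]].
elim: n => [|n IH] in H sH S S0 Sn ser *; first by rewrite -S0 Sn.
have [] := ser 0 isT; rewrite S0 => nS1 cS1.
have sS1 : is_subgroup (S 1%N) by case: nS1.
have ser1 i : (i < n)%N ->
    normal_in (S i.+2) (S i.+1) /\ cyclic_factor (S i.+1) (S i.+2).
  by move=> lt_in; exact: (ser i.+1).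
apply: (Qstep H (S 1%N)) => //; last exact: (IH (S 1%N) sS1 (S \o succn)).
by split=> //; exists n, (S \o succn).
Qed.

(** * Finite index and exponents *)

(** That [K] has finite index in [H], in a form that asks neither that [K] be
contained in [H] nor that the representatives lie in [H]. It passes at once to
smaller [H] and larger [K], and lists of representatives multiply. *)
Definition finitely_covered H K :=
  exists s : seq G, forall x, H x -> exists2 r, r \in s & K (r^-1 * x).

(** Among [1, x, ..., x^n], where [n] is the number of representatives, two
elements share a coset, so some [x^d] with [0 < d <= n] lies in [K]; the
exponent [n!] then serves all [x] at once. *)
Lemma pigeonhole_exp H K : is_subgroup H -> is_subgroup K ->
  finitely_covered H K ->
  exists m, forall x, H x -> K (x ^+ m.+1).
Proof.
move=> sH sK [s cov]; exists (size s)`!.-1 => x Hx; rewrite prednK ?fact_gt0 //.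
have /choice[r rP] : forall i, exists r, r \in s /\ K (r^-1 * x ^+ i).
  by move=> i; have [r] := cov _ (subgroup_exp i sH Hx); exists r.
have [i [j [lt_ij le_js eq_r]]] :
    exists i j, [/\ (i < j)%N, (j <= size s)%N & r i = r j].
  pose t := map r (iota 0 (size s).+1).
  have : ~~ uniq t.
    apply/negP => ut; have sts : {subset t <= s}.
      by move=> _ /mapP[i _ ->]; case: (rP i).
    by have := uniq_leq_size ut sts; rewrite size_map size_iota ltnn.
  move/(uniqPn 1) => [i [j [lt_ij]]]; rewrite size_map size_iota ltnS => le_j.
  have le_i := leq_trans (ltnW lt_ij) le_j.
  rewrite !(nth_map 0) ?size_iota ?ltnS // !nth_iota ?ltnS // !add0n.
  by exists i, j.
have Kd : K (x ^+ (j - i)).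
  have [_ KM KV] := sK.
  have [_ Ki] := rP i; have [_ Kj] := rP j.
  have := KM _ _ (KV _ Ki) Kj.
  rewrite eq_r invgM invgK -!mulgA mulVKg.
  suff -> : x ^- i * x ^+ j = x ^+ (j - i) by [].
  by rewrite -{1}(subnKC (ltnW lt_ij)) expgnDr mulKg.
have /dvdnP[q ->] : (j - i %| (size s)`!)%N.
  by rewrite dvdn_fact // subn_gt0 lt_ij (leq_trans (leq_subr _ _)).
by rewrite mulnC expgnA; exact: subgroup_exp.
Qed.

Lemma finitely_covered_powers g T m : is_subgroup T -> T (g ^+ m.+1) ->
  finitely_covered (powers g) T.
Proof.
move=> sT Tg; have [_ _ TV] := sT.
exists ([seq g ^+ j | j <- iota 0 m.+1] ++ [seq g ^- j | j <- iota 0 m.+1]).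
(* Reducing [k] modulo [m + 1] leaves finitely many positive and negative powers. *)
have red k : g ^+ k = g ^+ (k %% m.+1) * g ^+ m.+1 ^+ (k %/ m.+1).
  by rewrite -expgnA -expgnDr addnC mulnC -divn_eq.
have inr k : (k %% m.+1 \in iota 0 m.+1)%N by rewrite mem_iota ltn_pmod.
move=> _ [k [->|->]].
  exists (g ^+ (k %% m.+1)); first by rewrite mem_cat map_f.
  by rewrite (red k) mulKg; exact: subgroup_exp.
exists (g ^- (k %% m.+1)).
  by rewrite mem_cat (map_f (fun j => g ^- j)) ?orbT.
rewrite invgK.
suff -> : g ^+ (k %% m.+1) * g ^- k = (g ^+ m.+1 ^+ (k %/ m.+1))^-1.
  by apply: TV; exact: subgroup_exp.
by rewrite {2}(divn_eq k m.+1) mulnC expgnDr expgnA invgM mulVKg.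
Qed.

(** A polycyclic group of exponent [m + 1] is finite: each cyclic factor has at
most [m + 1] elements. Here the group is [H] modulo [T]. *)
Lemma finitely_covered_exponent H T m : polycyclic H -> is_subgroup T ->
  normalised T H -> (forall h, H h -> T (h ^+ m.+1)) -> finitely_covered H T.
Proof.
move=> pH sT; have [T1 TM TV] := sT; move: H pH.
apply: polycyclic_ind => [|H K sH _ nKH cK IH] nTH TX.
  by exists [:: 1] => _ ->; exists 1; rewrite ?inE ?mulVg.
have [_ KH _] := nKH.
have [|s sP] := IH _ (fun h Kh => TX h (KH h Kh)).
  by move=> x h Tx /KH; exact: nTH.
have [g Hg gen] := cyclic_factor_gen cK.
have [t tP] := finitely_covered_powers sT (TX g Hg).
exists [seq b * a | b <- t, a <- s] => x /gen[z [y [/tP[b tb Tb] Ky ->]]].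
have [a sa Ta] := sP y Ky.
exists (b * a); first by rewrite allpairs_f.
have -> : (b * a)^-1 * (z * y) = ((b^-1 * z) ^ y) ^ (a^-1 * y)^-1 * (a^-1 * y).
  by rewrite -conjgCV conjgE !mulgA mulgK invgM.
(* A representative [a] need not lie in [H], but [a^-1 * y] is in [T], so
   conjugating by it preserves [T]. *)
have Tw : T ((b^-1 * z) ^ y) by apply: nTH => //; exact: KH.
by apply: (TM) => //; rewrite conjgE invgK; apply: (TM) => //; apply: (TM) => //;
   exact: TV.
Qed.

(** * A torsion-free normal subgroup of finite index *)

(** By induction along the series it suffices to find a torsion-free subgroup
[L] containing all [m]-th powers of [H], as the [m]-th powers then generate a
subgroup of [L]. Let [K] be the next term, with its [L0] and [m0], and let [g]
generate [H] modulo [K]. If [H / K] is finite of order dividing [k], then [L0]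
itself contains the [k m0]-th powers. If [H / K] is infinite cyclic, the power
subgroup [M] of [K] replaces [L0]: it is torsion-free, of finite index in [K]
and, unlike [L0], normalised by [g]. So [L = M <g>] is a subgroup; its torsion
maps trivially to [H / K] and hence lies in [M], and its finite index in [H]
bounds an exponent. *)
Lemma polycyclic_torsion_free H : polycyclic H ->
  exists m, torsion_free (power_subgroup H m.+1).
Proof.
suff main : polycyclic H -> exists L m,
    [/\ is_subgroup L, torsion_free L & forall h, H h -> L (h ^+ m.+1)].
  move=> /main[L [m [sL tL LX]]]; exists m => x n.
  by move/(generated_sub sL) => /(_ _)/tL; apply=> _ [h Hh <-]; exact: LX.
move: H; apply: polycyclic_ind => [|H K sH pK nKH cK [L0 [m0 [sL0 tL0 L0X]]]].
  exists [set 1], 0; split=> [|_ n -> //|_ -> //].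
  by split=> // [_ _ -> ->|_ ->]; rewrite ?mulg1 ?invg1.
have [sK KH nK] := nKH.
have [g Hg gen] := cyclic_factor_gen cK.
have gH : powers g `<=` H by exact: sub_powers.
have [[k Kgk]|infg] := pselect (exists k, K (g ^+ k.+1)).
  exists L0, (k.+1 * m0.+1).-1; split=> // _ /gen[z [y [gz Ky ->]]].
  rewrite prednK ?muln_gt0 // expgnA; apply: L0X.
  have [y' Ky' ->] := expg_mulr_mod k.+1 sH sK nK (gH _ gz) Ky.
  have [_ KM KV] := sK; apply: KM => //.
  case: gz => j [->|->]; last rewrite -expVgn expgnAC expVgn.
    by rewrite expgnAC; exact: subgroup_exp.
  by apply: subgroup_exp => //; exact: KV.
pose M := power_subgroup K m0.+1.
have sM : is_subgroup M by exact: generated_subgroup.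
have MX h : K h -> M (h ^+ m0.+1) by move=> Kh; apply: sub_generated; exists h.
have ML0 : M `<=` L0 by apply: generated_sub => // _ [h Kh <-]; exact: L0X.
have MK : M `<=` K.
  by apply: generated_sub => // _ [h Kh <-]; exact: subgroup_exp.
have nMH : normalised M H by exact: power_subgroup_normalised.
have sP := powers_subgroup g.
pose L := [set x * z | x in M & z in powers g].
have sL : is_subgroup L.
  by apply: mulg_subgroup => // x h Mx /gH; exact: nMH.
have tL : torsion_free L.
  move=> _ n [x Mx [z gz <-]] xz1.
  have Hz := gH _ gz.
  have Kxz : K (x ^ z) by apply: nK => //; exact: MK.
  have [y Ky] := expg_mulr_mod n.+1 sH sK nK Hz Kxz.
  have xzE : z * x ^ z = x * z by rewrite conjgE mulVKg.
  rewrite xzE xz1 => /esym zy1.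
  have Kz : K (z ^+ n.+1).
    have -> : z ^+ n.+1 = y^-1 by rewrite -[LHS](mulgK y) zy1 mul1g.
    by case: sK => _ _; apply.
  suff z1 : z = 1.
    by move: xz1; rewrite z1 mulg1; apply: tL0; exact: ML0.
  case: gz Kz => [[|k] [->|->]]; rewrite ?expg0 ?invg1 //.
    by rewrite -expgnA mulSn addSn => Kg; case: infg; eexists; exact: Kg.
  rewrite expVgn -expgnA mulSn addSn => Kg; case: infg; eexists.
  by rewrite -[X in K X]invgK; case: sK => _ _; apply; exact: Kg.
have [|s sP'] := finitely_covered_exponent pK sM _ MX.
  by move=> x h Mx /KH; exact: nMH.
(* The decomposition is applied to [x^-1], which puts the factor from [K] on
   the left, where the coset representatives of [M] are needed. *)
have covL : finitely_covered H L.
  exists s => x Hx; have [_ _ HV] := sH.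
  have [z [y [gz Ky xE]]] := gen _ (HV _ Hx).
  have [_ _ KV] := sK; have [r sr Mr] := sP' _ (KV _ Ky).
  exists r => //; exists (r^-1 * y^-1) => //; exists z^-1.
    by case: sP => _ _; apply.
  by rewrite -(invgK x) xE invgM mulgA.
by have [m mP] := pigeonhole_exp sH sL covL; exists L, m.
Qed.

Lemma finite_set_covered H : finite_set H -> finitely_covered H [set 1].
Proof.
by move=> /finite_seqP[s ->]; exists s => x sx; exists x => //=; rewrite mulVg.
Qed.

Lemma lcoset_eq H x y : is_subgroup H -> H (x^-1 * y) ->
  lcoset H x = lcoset H y.
Proof.
move=> [_ HM HV] Hxy; apply/seteqP; split=> _ [h Hh <-].
  exists (y^-1 * x * h); last by rewrite !mulgA mulgV mul1g.
  by apply: HM => //; rewrite -(invgK x) -invgM; exact: HV.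
exists (x^-1 * y * h); last by rewrite !mulgA mulgV mul1g.
exact: HM.
Qed.

Lemma finite_index_covered H : is_subgroup H ->
  finite_index H -> finitely_covered setT H.
Proof.
move=> [H1 _ _] /finite_seqP[cs csE].
have rep C : exists r, (exists x, C = lcoset H x) -> C = lcoset H r.
  by have [[x ->]|nC] := pselect (exists x, C = lcoset H x);
     [exists x | exists 1 => /nC].
have /choice[r rP] := rep; exists (map r cs) => x _.
have csx : lcoset H x \in cs.
  suff : [set` cs] (lcoset H x) by [].
  by rewrite -csE; exists x.
exists (r (lcoset H x)); first exact: map_f.
have : lcoset H (r (lcoset H x)) x.
  by rewrite -rP; [exists 1; rewrite ?mulg1 | exists x].
by move=> [h Hh hx]; rewrite -[X in _ * X]hx mulKg.
Qed.

(** * Finite generation *)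

Lemma polycyclic_fin_gen H : polycyclic H ->
  exists s : seq G, forall K, is_subgroup K -> {in s, forall x, K x} -> H `<=` K.
Proof.
move: H; apply: polycyclic_ind => [|H K sH _ nKH cK [s sP]].
  by exists [::] => K [K1 _ _] _ _ ->.
have [g Hg gen] := cyclic_factor_gen cK.
exists (g :: s) => L sL Ls _ /gen[z [y [gz Ky ->]]].
have [_ LM _] := sL; apply: LM.
  by apply: sub_powers gz => //; apply: Ls; rewrite mem_head.
by apply: sP Ky => // x sx; apply: Ls; rewrite inE sx orbT.
Qed.

Lemma polycyclic_by_finite_fin_gen : polycyclic_by_finite G ->
  exists s : seq G, forall K, is_subgroup K -> {in s, forall x, K x} ->
    forall x, K x.
Proof.
move=> [P pP fP]; have [s sP] := polycyclic_fin_gen pP.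
have [t tP] := finite_index_covered (proj1 pP) fP.
exists (t ++ s) => K sK Ks x; have [r tr Pr] := tP x I.
rewrite -(mulVKg r x); have [_ KM _] := sK; apply: KM.
  by apply: Ks; rewrite mem_cat tr.
by apply: (sP K sK) Pr => y sy; apply: Ks; rewrite mem_cat sy orbT.
Qed.

(** * The torsion-free subgroup of a polycyclic-by-finite group *)

(** The exponent is a product: one factor brings powers into the polycyclic
subgroup [P], the other brings powers in [P] into a torsion-free subgroup. *)
Lemma polycyclic_by_finite_torsion_free : polycyclic_by_finite G ->
  exists D : set G,
    [/\ is_normal D, torsion_free D & finitely_covered setT D].
Proof.
move=> [P pP fP]; have sP := proj1 pP.
have sT : is_subgroup [set: G] by [].
have covP := finite_index_covered sP fP.
have [m1 tf] := polycyclic_torsion_free pP.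
have [m2 m2P] := pigeonhole_exp sT sP covP.
pose D := power_subgroup setT (m2.+1 * m1.+1).-1.+1.
have sD : is_subgroup D by exact: generated_subgroup.
have nD : normalised D setT by exact: power_subgroup_normalised.
have DX h : D (h ^+ (m2.+1 * m1.+1).-1.+1) by apply: sub_generated; exists h.
exists D; split.
- by split=> // x g Dx; exact: nD.
- move=> x n Dx; apply: tf; move: x Dx; apply: generated_sub.
    exact: generated_subgroup.
  move=> _ [h _ <-]; rewrite prednK ?muln_gt0 // expgnA.
  by apply: sub_generated; eexists; first exact: m2P.
- have nDP : normalised D P by move=> x h Dx _; exact: nD.
  have [s covD] := finitely_covered_exponent pP sD nDP (fun h _ => DX h).
  have [t tP] := covP.
  exists [seq a * b | a <- t, b <- s] => x _.
  have [a ta Pa] := tP x I; have [b sb Db] := covD _ Pa.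
  by exists (a * b); rewrite ?allpairs_f // invgM -mulgA.
Qed.

End SubgroupTools.

(** * Counting by finitely many labels *)

(** Each [x] in [A] assigns to every [i] in the finite list [s] a label [j]
from the finite list [t]. There are finitely many such assignments, and they
determine [f x]. The labelling is a relation because the labels used below,
coset representatives, need not be unique. *)
Lemma finite_image_of_labels (T U : Type) (I J : choiceType) (A : set T)
    (f : T -> U) (s : seq I) (t : seq J) (R : T -> I -> J -> Prop) :
  (forall x i, A x -> i \in s -> exists2 j, j \in t & R x i j) ->
  (forall x y, A x -> A y ->
     (forall i, i \in s -> exists j, R x i j /\ R y i j) -> f x = f y) ->
  finite_set (f @` A).
Proof.
move=> Rex Rinj.
have [[x0 Ax0]|nA] := pselect (exists x, A x); last first.
  suff -> : A = set0 by rewrite image_set0.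
  by apply/seteqP; split=> // x Ax; case: nA; exists x.
pose label x (c : {ffun seq_sub s -> seq_sub t}) :=
  A x /\ forall i, R x (val i) (val (c i)).
have labelP x : A x -> exists c, label x c.
  move=> Ax; have /choice[c cP] : forall i : seq_sub s, exists j : seq_sub t,
      R x (val i) (val j).
    by move=> [i si]; have [j tj Rj] := Rex x i Ax si; exists (SeqSub tj).
  by exists (finfun c); split=> // i; rewrite ffunE.
have /choice[g gP] : forall c, exists u, forall x, label x c -> f x = u.
  move=> c; have [[x [Ax xc]]|nc] := pselect (exists x, label x c).
    exists (f x) => y [Ay yc]; apply: Rinj => // i si.
    exists (val (c (SeqSub si))).
    by split; [exact: (yc (SeqSub si)) | exact: (xc (SeqSub si))].
  by exists (f x0) => y yc; case: nc; exists y.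
apply: (@sub_finite_set _ _ (range g)); last exact/finite_image/finite_finset.
move=> _ [x Ax <-]; have [c xc] := labelP x Ax.
by exists c => //; rewrite (gP c x).
Qed.

(** * Lifting automorphisms from the quotient *)

Lemma cosetV (G : groupType) (N : normalSubgroup G) (x : G) :
  coset N x^-1 = (coset N x)^-1.
Proof. exact: gmulfV. Qed.

Lemma cosetJ (G : groupType) (N : normalSubgroup G) (x y : G) :
  coset N (x ^ y) = coset N x ^ coset N y.
Proof. exact: gmulfJ. Qed.

Section Lifting.
Variables (G : groupType) (N : normalSubgroup G).
Hypothesis charN : characteristic N.
Variable D : set G.
Hypothesis nD : is_normal D.
Hypothesis ND1 : forall x, carrier N x -> D x -> x = 1.

(** [G] embeds in the product of [G / N] and [G / D]. *)
Lemma lift_unique (x y z : G) : D (x^-1 * y) -> D (x^-1 * z) ->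
  coset N y = coset N z -> y = z.
Proof.
have [[_ DM DV] _] := nD; move=> Dy Dz /eq_coset Nyz.
apply: (mulgI y^-1); rewrite mulVg; symmetry; apply: ND1 => //.
by have := DM _ _ (DV _ Dy) Dz; rewrite invgM invgK -!mulgA mulVKg.
Qed.

(** [phi] induces the identity on [G / DN]. *)
Definition trivial_mod (phi : Aut (quot N)) :=
  forall x, exists2 d, D d & phi (coset N x) = coset N (x * d).

Lemma trivial_modV phi : trivial_mod phi -> trivial_mod phi^-1.
Proof.
have [[_ _ DV] _] := nD; move=> phiD x.
have [d Dd] := phiD (repr (phi^-1 (coset N x))).
rewrite cosetM coset_repr aut_VK => xE; exists d^-1; first exact: DV.
by rewrite cosetM cosetV {2}xE mulgK.
Qed.

(** The lift sends [x] to the only element of [x D] lying over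
[phi (coset N x)]. By uniqueness it is multiplicative, and the lift of
[phi^-1] is its inverse. *)
Lemma trivial_mod_lift phi : trivial_mod phi ->
  exists f : Aut G, aut_quot charN f = phi.
Proof.
have [[D1 DM DV] DJ] := nD.
have section psi : trivial_mod psi -> exists f : G -> G,
    forall x, D (x^-1 * f x) /\ psi (coset N x) = coset N (f x).
  move=> psiD.
  have /choice[f fP] x : exists y, D (x^-1 * y) /\ psi (coset N x) = coset N y.
    by have [d Dd dE] := psiD x; exists (x * d); rewrite mulKg.
  by exists f.
move=> phiD; have [f fP] := section _ phiD.
have [h hP] := section _ (trivial_modV phiD).
have fM : {morph f : x y / x * y}.
  move=> x y; have [Dxy fxy] := fP (x * y).
  have [Dx fx] := fP x; have [Dy fy] := fP y.
  apply: (lift_unique Dxy); last by rewrite -fxy !cosetM autM fx fy.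
  have := DM _ _ (DJ _ y Dx) Dy.
  by rewrite conjgE invgM !mulgA mulgK.
have cancel_lift u v (psi : Aut (quot N)) : (forall x, D (x^-1 * u x) /\
      psi (coset N x) = coset N (u x)) ->
    (forall x, D (x^-1 * v x) /\ psi^-1 (coset N x) = coset N (v x)) ->
    cancel u v.
  move=> uP vP x; have [Dx ux] := uP x; have [Dux vux] := vP (u x).
  apply: (@lift_unique x); last by rewrite -vux -ux aut_KV.
    by have := DM _ _ Dx Dux; rewrite -mulgA mulVKg.
  by rewrite mulVg.
have f_aut : is_aut f.
  apply/asboolP; split=> //; exists h; first exact: (cancel_lift _ _ phi).
  by apply: (cancel_lift _ _ phi^-1) => // x; rewrite invgK.
exists (MkAut f_aut); apply: autP => a; rewrite -(coset_repr a) aut_quotE.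
by have [_ ->] := fP (repr a).
Qed.

End Lifting.

(** * The kernel and the image of the natural map *)

Lemma conj_aut_proof (G : groupType) (g : G) : is_aut (fun x : G => x ^ g).
Proof.
apply/asboolP; split=> [x y|]; first exact: conjMg.
by exists (fun x => x ^ g^-1) => x; rewrite ?conjgK ?conjgKV.
Qed.

Definition conj_aut (G : groupType) (g : G) : Aut G := MkAut (conj_aut_proof g).

Section FiniteKernelAndCokernel.
Variables (G : groupType) (N : normalSubgroup G).
Hypothesis charN : characteristic N.
Variable s : seq G.
Hypothesis sP : forall K, is_subgroup K -> {in s, forall x, K x} ->
  forall x, K x.

Lemma kernel_out_quot_rep (u : Out G) : out_quot charN u = 1 ->
  exists2 f : Aut G, coset (Inn G) f = u &
    forall x, carrier N (x^-1 * f x).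
Proof.
rewrite -(coset_repr u); move: (repr u) => f.
rewrite out_quotE => /coset_eq1[b fb].
(* Pulling [b^-1] back through [f] makes the conjugation cancel the one by [b]. *)
exists (f * conj_aut (f^-1 (repr b)^-1)).
  apply/eq_coset; rewrite invgM -mulgA mulVg mulg1.
  case: (normalSubgroupP (Inn G)) => [[_ _ IV] _]; apply: IV.
  by eexists.
move=> x; apply/eq_coset.
rewrite aut_mulE /= autJ aut_VK cosetJ cosetV coset_repr.
by rewrite -(aut_quotE charN) fb conjgK.
Qed.

Lemma finite_kernel_out_quot :
  finite_set N -> finite_set [set u | out_quot charN u = 1].
Proof.
move=> /finite_seqP[t tE].
have memt x : carrier N x <-> x \in t by rewrite tE.
pose A : set (Aut G) := [set f | forall x, carrier N (x^-1 * f x)].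
apply: (@sub_finite_set _ _ (coset (Inn G) @` A)).
  by move=> u /kernel_out_quot_rep[f <- fA]; exists f.
apply: (@finite_image_of_labels _ _ G G A _ s t (fun f x a => f x = x * a)).
  move=> f x fA _; exists (x^-1 * f x); first exact/memt/fA.
  by rewrite mulVKg.
move=> f g _ _ fg; congr (coset _ _); apply: autP; apply: sP.
  split=> [|x y fx fy|x fx] /=; rewrite ?aut1 ?autM ?autV //.
    by rewrite fx fy.
  by rewrite fx.
by move=> x /fg[a [-> ->]].
Qed.

Lemma range_out_quot_subgroup : is_subgroup (range (out_quot charN)).
Proof.
split; first by exists 1; rewrite ?out_quot1.
  by move=> _ _ [u _ <-] [v _ <-]; exists (u * v); rewrite ?out_quotM.
move=> _ [u _ <-]; exists u^-1 => //.
by apply: (mulgI (out_quot charN u)); rewrite -out_quotM !mulgV out_quot1.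
Qed.

(** Label the class of [alpha] by the classes of [alpha^-1 (coset N x)] modulo
the image of [D], for [x] in the generating list. If [alpha] and [beta] share
their labels then [alpha^-1] and [beta^-1] agree modulo the image of [D] on
generators, hence everywhere, so [alpha^-1 * beta] is trivial modulo that image
and lifts to [G]. *)
Lemma finite_index_out_quot (D : set G) : is_normal D ->
    finitely_covered setT D -> (forall x, carrier N x -> D x -> x = 1) ->
  finite_index (range (out_quot charN)).
Proof.
move=> nD [t tP] ND1; have [[D1 DM DV] DJ] := nD.
pose R (u : Out (quot N)) x r := exists2 d, D d &
  (repr u)^-1 (coset N x) = coset N (r * d).
apply: (@finite_image_of_labels _ _ G G setT _ s t R).
  move=> u x _ _; set a := (repr u)^-1 (coset N x).
  have [r tr Dr] := tP (repr a) I; exists r => //.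
  by exists (r^-1 * repr a) => //; rewrite mulVKg coset_repr.
move=> u v _ _ uv; apply: lcoset_eq; first exact: range_out_quot_subgroup.
set al := repr u in uv *; set be := repr v.
pose K := [set x | exists2 d, D d &
  al^-1 (coset N x) = be^-1 (coset N x) * coset N d].
have KT : forall x, K x.
  apply: sP.
    split=> [|x y [c Dc cE] [d Dd dE]|x [d Dd dE]] /=.
    - by exists 1 => //; rewrite -[coset N 1]/(1 : quot N) !aut1 mulg1.
    - exists (c ^ repr (be^-1 (coset N y)) * d).
        by apply: DM => //; exact: DJ.
      rewrite cosetM !autM cE dE cosetM cosetJ coset_repr conjgE.
      by rewrite !mulgA mulgK.
    - set b := be^-1 (coset N x).
      exists ((d^-1) ^ (repr b)^-1); first by apply: DJ; exact: DV.
      rewrite cosetV !autV dE cosetJ !cosetV coset_repr conjgE invgK.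
      by rewrite -/b invgM !mulgA mulVg mul1g.
  move=> x /uv[r [[c Dc cE] [d Dd dE]]]; exists (d^-1 * c).
    by apply: DM => //; exact: DV.
  by rewrite /al cE dE -cosetM -mulgA mulVKg.
have triv : trivial_mod D (al^-1 * be).
  move=> x; have [d Dd] := KT (repr (be (coset N x))).
  rewrite coset_repr aut_KV => E.
  by exists d => //; rewrite aut_mulE E cosetM.
have [f fE] := trivial_mod_lift charN nD ND1 triv.
exists (coset (Inn G) f) => //.
rewrite out_quotE fE cosetM cosetV /al /be !coset_repr //.
Qed.

End FiniteKernelAndCokernel.

Theorem proposition1p7 (Gamma : groupType)
    (polyGamma : polycyclic_by_finite Gamma)
    (tau : normalSubgroup Gamma) (maxtau : maximal_finite_normal tau) :
  finite_set (kernel (natural_out maxtau)) /\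
  (is_subgroup (range (natural_out maxtau)) /\
   finite_index (range (natural_out maxtau))).
Proof.
have [s sP] := polycyclic_by_finite_fin_gen polyGamma.
have [D [nD tD covD]] := polycyclic_by_finite_torsion_free polyGamma.
have fintau : finite_set tau by case: maxtau.
split; first exact: (finite_kernel_out_quot _ sP fintau).
split; first exact: range_out_quot_subgroup.
apply: (finite_index_out_quot _ sP nD covD) => x taux Dx.
have [stau _] := normalSubgroupP tau.
have s1 : is_subgroup [set (1 : Gamma)].
  by split=> // [_ _ -> ->|_ ->]; rewrite ?mulg1 ?invg1.
have [m mP] := pigeonhole_exp stau s1 (finite_set_covered fintau).
exact: tD (mP x taux).
Qed.
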